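(* Let $k$ be a field and let $$F = xy + h(z) + \sum_{i\ge 1} x^i f_i + \sum_{j\ge 2} y^j g_j \in \mathfrak m^2\subset k[[x,y,z]], \qquad \mathfrak m=(x,y,z),$$ where $h\in k[[z]]$, each of $f_i$ ($i\ge 1$) and $g_j$ ($j\geq 2$) is equal to a power of $z$ times a unit (or is zero), $0<\operatorname{ord} f_1<\infty$ and $\operatorname{ord} g_2>0$. Put $r_1=\operatorname{ord} f_1$, $m=\min_{j\ge 2}\{\,j r_1+\operatorname{ord} g_j\,\}$ and $\mu=\min\{\operatorname{ord} h,\, m\}$. Let $$H = h + f_1^2 g_2 - f_1^3 g_3 + \cdots = h+\sum_{j\ge 2}(-1)^j f_1^j g_j,$$ and let $\delta(\mu)$ be the coefficient of $z^\mu$ in $H$ (when $\mu<\infty$). Then: (a) $F$ defines an $\mathbf A_n$ singularity with $n\ge \mu-1$ ($n=\infty$ is possible). (b) $F$ defines an $\mathbf A_{\mu-1}$ singularity if $\delta(\mu)\neq 0$.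
   Context: For a series that is a power of $z$ times a unit of $k[[x,y,z]]$, say $z^r\cdot(\text{unit})$, its order is $\operatorname{ord}=r$; for $h\in k[[z]]$, $\operatorname{ord} h$ is the usual $z$-adic order; the zero series has order $\infty$. For finite $n$, $F$ defines an $\mathbf A_n$ singularity if $k[[x,y,z]]/(F)\cong k[[X,Y,Z]]/(XY-Z^{n+1})$ as $k$-algebras. The case $n=\infty$ means that $F$ factors: after a change of variables of $k[[x,y,z]]$ (an automorphism) $F$ becomes $XY$. *)

(* Defs.v *)
From HB Require Import structures.
From mathcomp Require Import all_boot all_order all_algebra.
From mathcomp Require Import generic_quotient ring_quotient.
From mathcomp Require Import mpoly.
From mathcomp Require Import boolp classical_sets functions cardinality fsbigop.

Set Implicit Arguments.
Unset Strict Implicit.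
Unset Printing Implicit Defensive.

Import GRing.Theory.
Local Open Scope classical_set_scope.
Local Open Scope quotient_scope.
Local Open Scope ring_scope.

Record mfps (n : nat) (R : Type) := MFps { mfps_coef :> 'X_{1..n} -> R }.

HB.instance Definition _ n R := gen_eqMixin (mfps n R).
HB.instance Definition _ n R := gen_choiceMixin (mfps n R).

Lemma mfpsP n R (f g : mfps n R) : (forall m, f m = g m) <-> f = g.
Proof.
case: f g => [f] [g]; split=> [/= fg|[->] //].
by congr MFps; apply/funext.
Qed.

Section MFpsRing.
Variables (n : nat) (R : comNzRingType).
Implicit Types f g h : mfps n R.

Definition mfps_zero : mfps n R := MFps (fun=> 0).
Definition mfps_opp f : mfps n R := MFps (fun m => - f m).
Definition mfps_add f g : mfps n R := MFps (fun m => f m + g m).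
Definition mfps_one : mfps n R := MFps (fun m => (m == 0%MM)%:R).
Definition mfps_mul f g : mfps n R := MFps (fun m =>
  \sum_(k : 'X_{1..n < (mdeg m).+1, (mdeg m).+1} | m == (k.1 + k.2)%MM)
    f k.1 * g k.2).
Definition mfps_scale (c : R) f : mfps n R := MFps (fun m => c * f m).

Let addA : associative mfps_add.
Proof. by move=> f g h; apply/mfpsP => m /=; rewrite addrA. Qed.
Let addC : commutative mfps_add.
Proof. by move=> f g; apply/mfpsP => m /=; rewrite addrC. Qed.
Let add0 : left_id mfps_zero mfps_add.
Proof. by move=> f; apply/mfpsP => m /=; rewrite add0r. Qed.
Let addN : left_inverse mfps_zero mfps_opp mfps_add.
Proof. by move=> f; apply/mfpsP => m /=; rewrite addNr. Qed.

HB.instance Definition _ :=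
  GRing.isZmodule.Build (mfps n R) addA addC add0 addN.

Definition mfps_trunc N f : {mpoly R[n]} :=
  \sum_(m : 'X_{1..n < N}) f m *: 'X_[m].

Lemma mfps_truncE N f m : (mdeg m < N)%N -> (mfps_trunc N f)@_m = f m.
Proof.
move=> mN; rewrite /mfps_trunc raddf_sum /= (bigD1 (BMultinom mN)) //= big1.
  by rewrite addr0 mcoeffZ mcoeffX eqxx mulr1.
move=> k kN; rewrite mcoeffZ mcoeffX; case: eqP => [km|]; last by rewrite mulr0.
by case/eqP: kN; apply/val_inj.
Qed.

Lemma mcoeffM_eq (p p' q q' : {mpoly R[n]}) m :
  (forall k, (mdeg k <= mdeg m)%N -> p@_k = p'@_k) ->
  (forall k, (mdeg k <= mdeg m)%N -> q@_k = q'@_k) ->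
  (p * q)@_m = (p' * q')@_m.
Proof.
move=> pp qq; rewrite !mcoeffM; apply: eq_bigr => -[k1 k2] _ /=.
by rewrite pp ?qq // -ltnS bmdeg.
Qed.

Lemma mfps_mulE N f g m : (mdeg m < N)%N ->
  mfps_mul f g m = (mfps_trunc N f * mfps_trunc N g)@_m.
Proof.
move=> mN; rewrite mcoeffM; apply: eq_bigr => -[k1 k2] _ /=.
by rewrite !mfps_truncE // (leq_trans _ mN) // bmdeg.
Qed.

Let mulA : associative mfps_mul.
Proof.
move=> f g h; apply/mfpsP => m.
rewrite !(@mfps_mulE (mdeg m).+1) //.
transitivity ((mfps_trunc (mdeg m).+1 f *
  (mfps_trunc (mdeg m).+1 g * mfps_trunc (mdeg m).+1 h))@_m).
  apply: mcoeffM_eq => // k km.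
  by rewrite mfps_truncE ?ltnS // (@mfps_mulE (mdeg m).+1).
rewrite mulrA; apply: mcoeffM_eq => // k km.
by rewrite mfps_truncE ?ltnS // (@mfps_mulE (mdeg m).+1).
Qed.

Let mulC : commutative mfps_mul.
Proof.
by move=> f g; apply/mfpsP => m; rewrite !(@mfps_mulE (mdeg m).+1) // mulrC.
Qed.

Let mul1 : left_id mfps_one mfps_mul.
Proof.
move=> f; apply/mfpsP => m; rewrite (@mfps_mulE (mdeg m).+1) //.
rewrite (@mcoeffM_eq _ 1 _ (mfps_trunc (mdeg m).+1 f)) //.
  by rewrite mul1r mfps_truncE.
by move=> k km; rewrite mfps_truncE ?ltnS // mcoeff1.
Qed.

Let mulDl : left_distributive mfps_mul mfps_add.
Proof.
move=> f g h; apply/mfpsP => m /=; rewrite -big_split /=.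
by apply: eq_bigr => k _; rewrite mulrDl.
Qed.

Let one_neq0 : mfps_one != 0.
Proof.
apply/eqP => /mfpsP /(_ 0%MM) /=; rewrite eqxx => /eqP.
by rewrite oner_eq0.
Qed.

HB.instance Definition _ :=
  GRing.Zmodule_isComNzRing.Build (mfps n R) mulA mulC mul1 mulDl one_neq0.

Let scaleA c d f : mfps_scale c (mfps_scale d f) = mfps_scale (c * d) f.
Proof. by apply/mfpsP => m /=; rewrite mulrA. Qed.
Let scale1 : left_id 1 mfps_scale.
Proof. by move=> f; apply/mfpsP => m /=; rewrite mul1r. Qed.
Let scaleDr : right_distributive mfps_scale +%R.
Proof. by move=> c f g; apply/mfpsP => m /=; rewrite mulrDr. Qed.
Let scaleDl f : {morph mfps_scale^~ f : c d / c + d}.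
Proof. by move=> c d; apply/mfpsP => m /=; rewrite mulrDl. Qed.

HB.instance Definition _ :=
  GRing.Zmodule_isLmodule.Build R (mfps n R) scaleA scale1 scaleDr scaleDl.

Let scaleAl (c : R) (f g : mfps n R) : c *: (f * g) = c *: f * g.
Proof.
apply/mfpsP => m /=; rewrite mulr_sumr.
by apply: eq_bigr => k _; rewrite mulrA.
Qed.

HB.instance Definition _ :=
  GRing.Lmodule_isLalgebra.Build R (mfps n R) scaleAl.
HB.instance Definition _ := GRing.Lalgebra_isComAlgebra.Build R (mfps n R).

Definition mfps_unit : {pred mfps n R} := fun f => `[< exists g, g * f = 1 >].
Definition mfps_inv f : mfps n R :=
  if f \in mfps_unit then xget f [set g | g * f = 1] else f.

Let mulVf : {in mfps_unit, left_inverse 1 mfps_inv *%R}.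
Proof.
move=> f uf; rewrite /mfps_inv uf; move/asboolP: uf => uf.
exact: (xgetPex f uf).
Qed.
Let unitP f g : g * f = 1 -> f \in mfps_unit.
Proof. by move=> gf; apply/asboolP; exists g. Qed.
Let inv_out : {in [predC mfps_unit], mfps_inv =1 id}.
Proof. by move=> f; rewrite inE /= /mfps_inv => /negbTE ->. Qed.

HB.instance Definition _ :=
  GRing.ComNzRing_hasMulInverse.Build (mfps n R) mulVf unitP inv_out.

Definition mfps_var (i : 'I_n) : mfps n R := MFps (fun m => (m == U_(i)%MM)%:R).

Lemma mfps_varME i f m :
  (mfps_var i * f) m = if (0 < m i)%N then f (m - U_(i))%MM else 0.
Proof.
rewrite [LHS](@mfps_mulE (mdeg m).+1) //.
rewrite (@mcoeffM_eq _ 'X_i _ (mfps_trunc (mdeg m).+1 f)) //; last first.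
  by move=> j jm; rewrite mfps_truncE ?ltnS //= mcoeffX eq_sym.
case: (ltnP 0) => im.
  have mE : (m - U_(i) + U_(i))%MM = m by rewrite submK // lep1mP -lt0n.
  have := mcoeffMX (mfps_trunc (mdeg m).+1 f) U_(i)%MM (m - U_(i))%MM.
  by rewrite addmC mE mulrC => ->; rewrite mfps_truncE // ltnS mdegB.
rewrite mcoeffM big1 // => -[j1 j2] /= /eqP mE; rewrite mcoeffX.
case: eqP => [j1E|]; last by rewrite mul0r.
by move: im; rewrite {1}mE -j1E mnmDE mnm1E eqxx.
Qed.

Lemma mfps_unit_neq0 f : f \is a GRing.unit -> f 0%MM != 0.
Proof.
move=> Uf; apply: contraTneq isT => f0.
have /(congr1 (fun h : mfps n R => h 0%MM)) := mulVr Uf.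
rewrite [LHS](@mfps_mulE 1) ?mdeg0 // (mcoeffM _ _ 0%MM).
rewrite big1 => [/esym|[j1 j2] /= /eqP /esym/eqP].
  by move/eqP; rewrite [_ 0%MM]/(_%:R) eqxx oner_eq0.
rewrite mnmD_eq0 => /andP[_ /eqP j20]; rewrite j20.
by rewrite [X in _ * X]mfps_truncE ?mdeg0 // f0 mulr0.
Qed.

(** The sum of a family indexed by [A : set nat] that is summable for the
    m-adic topology: each coefficient of the sum is a sum with finitely many
    nonzero terms. *)
Definition mfps_sum (A : set nat) (u : nat -> mfps n R) : mfps n R :=
  MFps (fun m => \sum_(i \in A) u i m).

Lemma mfps_sumE (A : set nat) (u : nat -> mfps n R) N m :
  (forall i, (N <= i)%N -> u i m = 0) ->
  mfps_sum A u m = \sum_(0 <= i < N | i \in A) u i m.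
Proof.
move=> u0 /=; rewrite (@fsbigE _ _ _ _ A [seq i <- iota 0 N | i \in A]) /=.
- by rewrite big_filter_cond /index_iota subn0; apply: eq_bigl => i; rewrite andbb.
- by rewrite filter_uniq ?iota_uniq.
- by move=> i /=; rewrite mem_filter => /andP[]; rewrite inE.
move=> i Ai; rewrite mem_filter mem_iota add0n /= mem_set //= => iN.
by apply: u0; rewrite leqNgt.
Qed.

End MFpsRing.

Notation "\msum_ ( i 'in' A ) u" := (mfps_sum A (fun i => u))
  (at level 36, i at level 0, A at level 41, u at level 36) : ring_scope.

Section PrincipalQuotient.
Variables (k : comNzRingType) (A : comAlgType k) (a : A).

Definition principal : {pred A} := fun f => `[< exists b, f = b * a >].

Lemma principalP f : reflect (exists b, f = b * a) (f \in principal).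
Proof. exact: asboolP. Qed.

Lemma principal_zmod_closed : zmod_closed principal.
Proof.
split=> [|_ _ /principalP[b ->] /principalP[c ->]]; apply/principalP.
  by exists 0; rewrite mul0r.
by exists (b - c); rewrite mulrBl.
Qed.

HB.instance Definition _ :=
  GRing.isZmodClosed.Build A principal principal_zmod_closed.

(** The library's quotient ring [{ideal_quot I}] requires [I] to be proper and
    carries no scalar action; here the zero ring is allowed. *)
Definition pquot : Type := {ideal_quot principal}.
HB.instance Definition _ := GRing.Zmodule.on pquot.

Definition pquot_pi (f : A) : pquot := \pi_{ideal_quot principal} f.
Definition pquot_repr (x : pquot) : A := repr (x : {ideal_quot principal}).

Lemma pquot_reprK : cancel pquot_repr pquot_pi.
Proof. exact: reprK. Qed.

Lemma pquot_piP f g : pquot_pi f = pquot_pi g <-> exists b, f - g = b * a.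
Proof.
have fgE : (f - g \in principal) = (pquot_pi f == pquot_pi g).
  by rewrite Quotient.idealrBE.
split=> [/eqP|/principalP fg]; first by rewrite -fgE => /principalP.
by apply/eqP; rewrite -fgE.
Qed.

Lemma pquot_pi_is_zmod_morphism : zmod_morphism pquot_pi.
Proof. by move=> f g; rewrite /pquot_pi raddfB. Qed.

HB.instance Definition _ :=
  GRing.isZmodMorphism.Build A pquot pquot_pi pquot_pi_is_zmod_morphism.

Definition pquot_one : pquot := pquot_pi 1.
Definition pquot_mul (x y : pquot) : pquot :=
  pquot_pi (pquot_repr x * pquot_repr y).
Definition pquot_scale (c : k) (x : pquot) : pquot :=
  pquot_pi (c *: pquot_repr x).

Lemma pquot_piM f g : pquot_pi (f * g) = pquot_mul (pquot_pi f) (pquot_pi g).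
Proof.
apply/pquot_piP.
have /esym/pquot_piP[b bE] := pquot_reprK (pquot_pi f).
have /esym/pquot_piP[c cE] := pquot_reprK (pquot_pi g).
exists (b * g + pquot_repr (pquot_pi f) * c).
rewrite mulrDl mulrAC -bE -mulrA -cE mulrBl mulrBr addrA subrK.
by [].
Qed.

Lemma pquot_piZ c f : pquot_pi (c *: f) = pquot_scale c (pquot_pi f).
Proof.
apply/pquot_piP.
have /esym/pquot_piP[b bE] := pquot_reprK (pquot_pi f).
by exists (c *: b); rewrite -scalerBr bE scalerAl.
Qed.

Let piE := (pquot_piM, pquot_piZ).
Let mulA : associative pquot_mul.
Proof.
move=> x y z; rewrite -[x]pquot_reprK -[y]pquot_reprK -[z]pquot_reprK.
by rewrite -!piE mulrA.
Qed.
Let mulC : commutative pquot_mul.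
Proof.
by move=> x y; rewrite -[x]pquot_reprK -[y]pquot_reprK -!piE mulrC.
Qed.
Let mul1 : left_id pquot_one pquot_mul.
Proof. by move=> x; rewrite -[x]pquot_reprK -!piE mul1r. Qed.
Let mulDl : left_distributive pquot_mul +%R.
Proof.
move=> x y z; rewrite -[x]pquot_reprK -[y]pquot_reprK -[z]pquot_reprK.
by rewrite -raddfD -!piE -raddfD mulrDl.
Qed.

HB.instance Definition _ :=
  GRing.Zmodule_isComPzRing.Build pquot mulA mulC mul1 mulDl.

Let scaleA c d x : pquot_scale c (pquot_scale d x) = pquot_scale (c * d) x.
Proof. by rewrite -[x]pquot_reprK -!piE scalerA. Qed.
Let scale1 : left_id 1 pquot_scale.
Proof. by move=> x; rewrite -[x]pquot_reprK -!piE scale1r. Qed.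
Let scaleDr : right_distributive pquot_scale +%R.
Proof.
move=> c x y; rewrite -[x]pquot_reprK -[y]pquot_reprK.
by rewrite -raddfD -!piE -raddfD scalerDr.
Qed.
Let scaleDl x : {morph pquot_scale^~ x : c d / c + d}.
Proof.
by move=> c d; rewrite -[x]pquot_reprK -!piE -raddfD scalerDl.
Qed.

HB.instance Definition _ :=
  GRing.Zmodule_isLmodule.Build k pquot scaleA scale1 scaleDr scaleDl.

Lemma pquot_pi_is_monoid_morphism : monoid_morphism pquot_pi.
Proof. by split=> // f g; rewrite pquot_piM. Qed.
HB.instance Definition _ :=
  GRing.isMonoidMorphism.Build A pquot pquot_pi pquot_pi_is_monoid_morphism.

Lemma pquot_pi_is_scalable : scalable pquot_pi.
Proof. by move=> c f; rewrite pquot_piZ. Qed.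
HB.instance Definition _ :=
  GRing.isScalable.Build k A pquot *:%R pquot_pi pquot_pi_is_scalable.

End PrincipalQuotient.

(** [{lrmorphism _ -> _}] needs nonzero rings, so a homomorphism of k-algebras
    between quotients is a ring morphism that is k-linear. *)
Definition quot_alg_isomorphic (k : comNzRingType) (A B : comAlgType k)
    (a : A) (b : B) : Prop :=
  exists phi : {rmorphism pquot a -> pquot b}, scalable phi /\ bijective phi.

Section Ideals.
Variable A : comNzRingType.

Definition ideal_gen (s : seq A) : set A :=
  [set f | exists c : 'I_(size s) -> A, f = \sum_(i < size s) c i * s`_i].

Definition ideal_mul (I J : set A) : set A :=
  [set f | exists n (a b : 'I_n -> A),
     (forall i, I (a i) /\ J (b i)) /\ f = \sum_(i < n) a i * b i].

End Ideals.

Inductive enat := Fin of nat | Infty.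

Definition eaddn (a b : enat) : enat :=
  if (a, b) is (Fin m, Fin n) then Fin (m + n) else Infty.
Definition elen (a b : enat) : bool :=
  match a, b with
  | _, Infty => true
  | Infty, Fin _ => false
  | Fin m, Fin n => (m <= n)%N
  end.
Definition epred (a : enat) : enat := if a is Fin n then Fin n.-1 else Infty.

Lemma asbool_ex (P : nat -> Prop) : (exists n, P n) -> exists n, `[< P n >].
Proof. by case=> n Pn; exists n; apply/asboolP. Qed.

(** A set without finite elements, in particular set0, gets [Infty]. *)
Definition emin (S : set enat) : enat :=
  if pselect (exists n, S (Fin n)) is left ex then Fin (ex_minn (asbool_ex ex))
  else Infty.

Lemma emin_le (S : set enat) a : S a -> elen (emin S) a.
Proof.
case: a => [n|_]; last by case: (emin S).
rewrite /emin; case: pselect => [ex|nex] Sn; last by case: nex; exists n.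
by case: ex_minnP => m _ /(_ n); apply; apply/asboolP.
Qed.

Lemma emin_mem (S : set enat) : S !=set0 -> S (emin S).
Proof.
case=> a Sa; rewrite /emin; case: pselect => [ex|nex].
  by case: ex_minnP => m /asboolP.
by case: a Sa => // n Sn; case: nex; exists n.
Qed.

Section ThreeVariables.
Variable k : fieldType.
Local Notation S := (mfps 3 k).

Definition ix : 'I_3 := @Ordinal 3 0 isT.
Definition iy : 'I_3 := @Ordinal 3 1 isT.
Definition iz : 'I_3 := @Ordinal 3 2 isT.

Definition xv : S := mfps_var k ix.
Definition yv : S := mfps_var k iy.
Definition zv : S := mfps_var k iz.

Definition maxideal : set S := ideal_gen [:: xv; yv; zv].

Definition in_kz : set S :=
  [set h : S | forall m : 'X_{1..3}, h m != 0 -> m ix = 0%N /\ m iy = 0%N].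

Definition zpow_unit (f : S) : Prop :=
  exists (r : nat) (u : S), u \is a GRing.unit /\ f = zv ^+ r * u.

(** The z-adic order; it is r on z^r * unit, see [zord_zpow_unit]. *)
Definition zord (f : S) : enat :=
  emin [set Fin (m iz) | m in [set m : 'X_{1..3} | f m != 0]].

Lemma zord0 : zord 0 = Infty.
Proof.
rewrite /zord /emin; case: pselect => // ex; case: (ex) => n [m] /=.
by rewrite eqxx.
Qed.

Lemma zord_eqP (f : S) n :
  (exists2 m : 'X_{1..3}, m iz = n & f m != 0) ->
  (forall m : 'X_{1..3}, f m != 0 -> (n <= m iz)%N) -> zord f = Fin n.
Proof.
case=> m mn fm le_n.
have: elen (zord f) (Fin n) by apply: emin_le; exists m => //=; rewrite mn.
have: [set Fin (m iz) | m in [set m : 'X_{1..3} | f m != 0]] (zord f).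
  by apply: emin_mem; exists (Fin (m iz)), m.
case=> m' /= /le_n nm <- /= m'n; congr Fin; apply/eqP.
by rewrite eqn_leq m'n nm.
Qed.

Lemma zpowE r (f : S) (m : 'X_{1..3}) :
  (zv ^+ r * f) m = if (r <= m iz)%N then f (m - U_(iz) *+ r)%MM else 0.
Proof.
elim: r m => [|r IHr] m; first by rewrite mul1r mulm0n subm0.
rewrite exprS -mulrA [LHS]mfps_varME IHr mnmBE mnm1E eqxx mulmS -submDA.
by case: (m iz) => // a; rewrite subn1 ltnS.
Qed.

Lemma zord_zpow_unit r (u : S) : u \is a GRing.unit -> zord (zv ^+ r * u) = Fin r.
Proof.
move=> Uu; apply: zord_eqP.
  exists (U_(iz) *+ r)%MM; first by rewrite mulmnE mnm1E eqxx mul1n.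
  rewrite zpowE mulmnE mnm1E eqxx mul1n leqnn.
  have -> : (U_(iz) *+ r - U_(iz) *+ r)%MM = 0%MM :> 'X_{1..3}.
    by apply/mnmP => i; rewrite mnmBE mnm0E subnn.
  exact: mfps_unit_neq0.
by move=> m; rewrite zpowE; case: leqP => //; rewrite eqxx.
Qed.

Lemma zord_kz (h : S) n : in_kz h -> h (U_(iz) *+ n)%MM != 0 ->
  (forall i, (i < n)%N -> h (U_(iz) *+ i)%MM = 0) -> zord h = Fin n.
Proof.
move=> hz hn h0; apply: zord_eqP.
  by exists (U_(iz) *+ n)%MM => //; rewrite mulmnE mnm1E eqxx mul1n.
move=> m hm; rewrite leqNgt; apply/negP => /h0/eqP; apply/negP.
suff -> : (U_(iz) *+ m iz)%MM = m by [].
have [mx my] := hz _ hm; apply/mnmP => i; rewrite mulmnE mnm1E.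
case: (eqVneq iz i) => [<-|]; first by rewrite mul1n.
rewrite mul0n; case: i => -[|[|[|i]]] //= li _.
- by rewrite -[LHS]mx; congr (m _); apply: val_inj.
- by rewrite -[LHS]my; congr (m _); apply: val_inj.
Qed.

Definition A_sing (n : nat) (F : S) : Prop :=
  quot_alg_isomorphic F (xv * yv - zv ^+ n.+1).

Definition A_infty_sing (F : S) : Prop :=
  exists phi : {lrmorphism S -> S}, bijective phi /\ phi F = xv * yv.

Definition A_sing_ext (n : enat) (F : S) : Prop :=
  if n is Fin n' then A_sing n' F else A_infty_sing F.

End ThreeVariables.

(* Main.v *)
From HB Require Import structures.
Require Import Defs.
From mathcomp Require Import all_boot all_order all_algebra.
From mathcomp Require Import mpoly.
From mathcomp Require Import boolp classical_sets functions cardinality fsbigop.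
From mathcomp Require Import zify ring.

Set Implicit Arguments.
Unset Strict Implicit.
Unset Printing Implicit Defensive.

Import GRing.Theory.
Local Open Scope classical_set_scope.
Local Open Scope ring_scope.

(** Write [F = x y + E].  Suppose that [D] solves [D = E - D1 D2], where
    [D = c(z) + x D1 + y D2] is the division of [D] by [x] and then by [y] (so
    [x] does not occur in [D2]).  Then

      [F = x y + x D1 + y D2 + D1 D2 + c(z) = (x + D2) (y + D1) + c(z)],

    and everything can be read off from [c]: if [X = x + D2], [Y = y + D1] and
    [z] are coordinates, then [F] is [XY] when [c = 0], and it is a unit times
    [xy - z^(n+1)], in suitable coordinates, when [c] has order [n + 1].

    The equation is solved by recursion on the weighted degree that gives [x],
    [y], [z] the weights 3, 2, 3 ([splitting]).  These weights are chosen such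
    that [y] is lighter than [x] and [z] but [y^2] is heavier than both; then
    [D1] and [D2] are made of monomials heavier than [y] and [x] respectively,
    so the coefficients of [D1 D2] at a monomial involve only coefficients of
    [D] at lighter ones.  For the same reason [X], [Y], [z] agree with [x], [y],
    [z] up to heavier terms, and a substitution of this kind is an automorphism
    ([mfps_autP]): it is triangular for the weight.

    It remains to compare [c] with [H] ([zcoef_H]).  Let [r = ord f_1] and let
    [N] be a finite lower bound of all [j r + ord g_j] with [2 r < N]; the
    number [m] itself is such a bound when it is finite.  Give [x], [y], [z]
    the weights [N - r], [r], [1].  Apart from [h], all of [E] has weight at
    least [N], hence so has [D - h], because [D1] and [D2] have weight at least
    [r] and [N - r].  Hence [c] and [h] agree below [z^N].  In weight [N], with
    [a] the coefficient of [z^r] in [f_1], the only monomial of [D1] that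
    matters is [a z^r], and the equation for [D] becomes the recursion

      [d_j = e_j - a d_(j+1)]

    between the coefficients [d_j], [e_j] of [y^j z^(N - j r)] in [D] and [E].
    Unwinding it gives [d_0 = sum_j (-a)^j e_j].  Here [e_0] is the coefficient
    of [z^N] in [h], [e_1 = 0], and [e_j] is the coefficient of [z^(N - j r)] in
    [g_j] for [j >= 2]; so [d_0] is the coefficient of [z^N] in [H]. *)

(** * Recursion on a measure, and coefficients of power series *)

(** A self-map that determines each value from the values of smaller measure
    has a fixed point; every implicit equation between power series below is
    solved in this way, one coefficient after the other.  The value at [i] is
    stationary after [d i + 1] iterations. *)
Lemma measured_fixpoint (I R : Type) (d : I -> nat)
    (T : (I -> R) -> I -> R) (f0 : I -> R) :
  (forall f f' i, (forall j, (d j < d i)%N -> f j = f' j) -> T f i = T f' i) ->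
  exists f, forall i, T f i = f i.
Proof.
move=> Td.
have step n i : (d i < n)%N -> iter n T f0 i = iter n.+1 T f0 i.
  elim: n i => // n IHn i; rewrite ltnS => din /=.
  by apply: Td => j dji; apply: IHn; apply: leq_trans dji din.
have stable n i : (d i < n)%N -> iter n T f0 i = iter (d i).+1 T f0 i.
  elim: n => // n IHn; rewrite ltnS leq_eqVlt => /predU1P[-> //|din].
  by rewrite -step // IHn.
exists (fun i => iter (d i).+1 T f0 i) => i; apply: Td => j dji.
by rewrite -(stable (d i)).
Qed.

Section Coefficients.
Variables (n : nat) (R : comNzRingType).
Implicit Types (f g : mfps n R) (m p q : 'X_{1..n}).

Lemma mfps1E m : (1 : mfps n R) m = (m == 0%MM)%:R. Proof. by []. Qed.
Lemma mfpsDE f g m : (f + g) m = f m + g m. Proof. by []. Qed.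
Lemma mfpsNE f m : (- f) m = - f m. Proof. by []. Qed.
Lemma mfpsZE c f m : (c *: f) m = c * f m. Proof. by []. Qed.

Lemma mfps_bigE (I : Type) (s : seq I) (P : pred I) (u : I -> mfps n R) m :
  (\sum_(i <- s | P i) u i) m = \sum_(i <- s | P i) u i m.
Proof. exact: (big_morph (fun f : mfps n R => f m)). Qed.

Lemma mfpsM_eq (f f' g g' : mfps n R) m :
  (forall p q, (p + q)%MM = m -> f p * g q = f' p * g' q) ->
  (f * g) m = (f' * g') m.
Proof. by move=> fg; apply: eq_bigr => k /eqP/esym/fg. Qed.

Lemma mfpsM_eq0 f g m :
  (forall p q, (p + q)%MM = m -> f p * g q = 0) -> (f * g) m = 0.
Proof. by move=> fg; apply: big1 => k /eqP/esym/fg. Qed.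

Lemma mfpsM_single f g p q :
  (forall p' q', (p' + q' = p + q)%MM -> p' != p -> f p' * g q' = 0) ->
  (f * g) (p + q)%MM = f p * g q.
Proof.
move=> fg.
have pm : (mdeg p < (mdeg (p + q)).+1)%N by rewrite mdegD ltnS leq_addr.
have qm : (mdeg q < (mdeg (p + q)).+1)%N by rewrite mdegD ltnS leq_addl.
rewrite [LHS](bigD1 (BMultinom pm, BMultinom qm)) //= big1 ?addr0 //.
move=> -[p' q'] /= /andP[/eqP/esym pq]; apply: contra_neq_eq => nz.
have pE : bmnm p' = p by apply: contra_neq_eq nz; exact: fg.
have qE : bmnm q' = q by move: pq; rewrite pE; apply: addmI.
by congr (_, _); apply: val_inj.
Qed.

Lemma mfpsM0 f g : (f * g) 0%MM = f 0%MM * g 0%MM.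
Proof.
rewrite -{1}[0%MM]addm0; apply: mfpsM_single => p q /eqP.
by rewrite addm0 mnmD_eq0 => /andP[/eqP-> _]; rewrite eqxx.
Qed.

Lemma mfps_var_expM i r f m :
  (mfps_var R i ^+ r * f) m = if (r <= m i)%N then f (m - U_(i) *+ r)%MM else 0.
Proof.
elim: r m => [|r IHr] m; first by rewrite mul1r mulm0n subm0.
rewrite exprS -mulrA [LHS]mfps_varME IHr mnmBE mnm1E eqxx mulmS -submDA.
by case: (m i) => // a; rewrite subn1 ltnS.
Qed.

Lemma mfps_var0 (i : 'I_n) : mfps_var R i (0%MM : 'X_{1..n}) = 0.
Proof.
rewrite /= (_ : _ == _ = false) //; apply/eqP => /mnmP/(_ i).
by rewrite mnm1E mnm0E eqxx.
Qed.

Lemma mfps_sum_eq0 (A : set nat) (u : nat -> mfps n R) m :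
  (forall i, i \in A -> u i m = 0) -> (\msum_(i in A) u i) m = 0.
Proof. by move=> u0 /=; apply: fsbig1 => i Ai; rewrite u0 // mem_set. Qed.

End Coefficients.

(** The inverse [g] of [f = f(0) - e] is the solution of
    [g = f(0)^-1 (1 + g e)], a recursion on the degree since [e(0) = 0]. *)
Lemma mfps_unitP (n : nat) (k : fieldType) (f : mfps n k) :
  f 0%MM != 0 -> f \is a GRing.unit.
Proof.
move=> f0; pose e : mfps n k := (f 0%MM) *: 1 - f.
have e0 : e 0%MM = 0 by rewrite mfpsDE mfpsNE mfpsZE mfps1E eqxx mulr1 subrr.
pose T (g : 'X_{1..n} -> k) m := (f 0%MM)^-1 * (1 + MFps g * e) m.
have [g gT] : exists g, forall m, T g m = g m.
  apply: (@measured_fixpoint _ _ mdeg _ (fun=> 0)) => g g' m gg'.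
  rewrite /T !mfpsDE.
  congr (_ * (_ + _)); apply: mfpsM_eq => p q pq.
  have [->|q0] := eqVneq q 0%MM; first by rewrite e0 !mulr0.
  by congr (_ * _); apply: gg'; rewrite -pq mdegD -addn1 leq_add2l lt0n mdeg_eq0.
apply/asboolP; exists (MFps g).
have e_eq : (f 0%MM)%:A * MFps g = 1 + MFps g * e.
  apply/mfpsP => m; rewrite -scalerAl mul1r mfpsZE -[MFps g m]gT.
  by rewrite /T mulVKf.
have -> : f = (f 0%MM)%:A - e by rewrite /e; ring.
by rewrite mulrBr mulrC e_eq addrK.
Qed.

(** * Weighted degrees and leading monomials *)

Section WeightedDegree.
Variables (n : nat) (wt : 'I_n -> nat).

Definition wdeg (m : 'X_{1..n}) : nat := (\sum_i m i * wt i)%N.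

Lemma wdeg0 : wdeg 0%MM = 0%N.
Proof. by rewrite /wdeg big1 // => i _; rewrite mnm0E. Qed.

Lemma wdegD p q : wdeg (p + q)%MM = (wdeg p + wdeg q)%N.
Proof.
by rewrite /wdeg -big_split /=; apply: eq_bigr => i _; rewrite mnmDE mulnDl.
Qed.

Variable R : comNzRingType.

(** The part of [f] of weight at most that of [m] is the single term [a m]; all
    other terms of [f] are strictly heavier. *)
Definition leads (f : mfps n R) (m : 'X_{1..n}) (a : R) :=
  forall p, (wdeg p <= wdeg m)%N -> f p = a *+ (p == m).

Lemma leads1 : leads 1 0%MM 1. Proof. by []. Qed.

(** If [p' + q'] is no heavier than [p + q], then either one of [p'], [q'] is
    lighter than its counterpart or both weights agree. *)
Lemma leadsM f g p q a b :
  leads f p a -> leads g q b -> leads (f * g) (p + q)%MM (a * b).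
Proof.
move=> fp gq m; rewrite wdegD => mpq.
have fg p' q' : (p' + q')%MM = m ->
    f p' * g q' = a * b *+ ((p' == p) && (q' == q)).
  move=> pqm; have dm := wdegD p' q'; rewrite pqm in dm.
  have [p'p|pp'] := leqP (wdeg p') (wdeg p).
    have [q'q|qq'] := leqP (wdeg q') (wdeg q).
      by rewrite fp // gq //; do 2 case: (_ == _);
        rewrite /= ?mulr0n ?mulr1n ?mulr0 ?mul0r.
    have lt : (wdeg p' < wdeg p)%N by lia.
    rewrite fp 1?ltnW //; case: eqP => [E|_]; first by rewrite E ltnn in lt.
    by rewrite mul0r.
  have lt : (wdeg q' < wdeg q)%N by lia.
  rewrite gq 1?ltnW //; case: (q' =P q) => [E|_]; first by rewrite E ltnn in lt.
  by rewrite mulr0 andbF.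
have [mE|nm] := eqVneq m (p + q)%MM.
  rewrite mE (@mfpsM_single _ _ _ _ p q) ?fg ?eqxx //.
  by move=> p' q' pq /negbTE p'p; rewrite fg ?mE // p'p.
apply: mfpsM_eq0 => p' q' pq; rewrite fg //.
case: eqP => // pE; case: eqP => //= qE.
by rewrite -pq pE qE eqxx in nm.
Qed.

End WeightedDegree.

(** * Substitution and automorphisms *)

Section Substitution.
Variables (n : nat) (R : comNzRingType) (u : 'I_n -> mfps n R).
Local Notation S := (mfps n R).
Implicit Types (f g : S) (p q : {mpoly R[n]}) (m : 'X_{1..n}).

Definition mfps_peval : {mpoly R[n]} -> S := mmap (in_alg S) u.

(** The coefficient at [m] of [f(u_1, ..., u_n)] is that of a truncation of [f],
    evaluated as a polynomial: when the [u_i] have no constant term, the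
    monomials of degree above that of [m] do not contribute. *)
Definition mfps_subst f : S :=
  MFps (fun m => mfps_peval (mfps_trunc (mdeg m).+1 f) m).

Lemma mfps_pevalE p m :
  mfps_peval p m = \sum_(j <- msupp p) p@_j * mmap1 u j m.
Proof.
rewrite /mfps_peval /mmap mfps_bigE; apply: eq_bigr => j _.
by rewrite -scalerAl mul1r.
Qed.

Hypothesis u0 : forall i, u i (0%MM : 'X_{1..n}) = 0.

Lemma mmap1_low j m : (mdeg m < mdeg j)%N -> mmap1 u j m = 0.
Proof.
rewrite /mmap1 [mdeg j]mdegE; move: m.
apply: (big_rec2 (fun (f : S) d => forall m, (mdeg m < d)%N -> f m = 0)).
  by move=> m; rewrite ltn0.
move=> i f d _ IHf; elim: (j i) => [|r IHr] m; first by rewrite mul1r; apply: IHf.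
rewrite exprS -mulrA => mr; apply: mfpsM_eq0 => p q pq.
have [->|p0] := eqVneq p 0%MM; first by rewrite u0 mul0r.
rewrite IHr ?mulr0 //; move: mr; rewrite -pq mdegD -mdeg_eq0 in p0 *; lia.
Qed.

(** Any polynomial that agrees with [f] up to the degree of [m] can replace the
    truncation, so that the laws of a homomorphism descend from polynomials. *)
Lemma mfps_substE f p m :
  (forall j, (mdeg j <= mdeg m)%N -> p@_j = f j) ->
  mfps_subst f m = mfps_peval p m.
Proof.
move=> pf; apply/eqP; rewrite -subr_eq0.
have -> : mfps_subst f m - mfps_peval p m
    = mfps_peval (mfps_trunc (mdeg m).+1 f - p) m by rewrite /mfps_peval raddfB.
rewrite mfps_pevalE; apply/eqP; apply: big1_seq => j _.
have [jm|mj] := leqP (mdeg j) (mdeg m).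
  by rewrite mcoeffB pf // mfps_truncE ?ltnS // subrr mul0r.
by rewrite mmap1_low // mulr0.
Qed.

Lemma mfps_subst_zmod : zmod_morphism mfps_subst.
Proof.
move=> f g; apply/mfpsP => m; pose t := @mfps_trunc n R (mdeg m).+1.
rewrite (@mfps_substE _ (t f - t g)) => [|j jm].
  by rewrite /mfps_peval raddfB.
by rewrite mcoeffB !mfps_truncE.
Qed.

Lemma mfps_subst_monoid : monoid_morphism mfps_subst.
Proof.
split=> [|f g]; apply/mfpsP => m.
  rewrite (@mfps_substE _ 1) => [|j jm]; last by rewrite mcoeff1.
  by rewrite /mfps_peval rmorph1.
pose t := @mfps_trunc n R (mdeg m).+1.
rewrite (@mfps_substE _ (t f * t g)) => [|j jm].
  rewrite /mfps_peval rmorphM; apply: mfpsM_eq => a b ab.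
  by congr (_ * _); apply/esym/mfps_substE => j jm; rewrite mfps_truncE // ltnS;
    apply: leq_trans jm _; rewrite -ab mdegD ?leq_addl ?leq_addr.
by rewrite -mfps_mulE.
Qed.

Lemma mfps_subst_scalable : scalable mfps_subst.
Proof.
move=> c f; apply/mfpsP => m; pose t := @mfps_trunc n R (mdeg m).+1.
rewrite (@mfps_substE _ (c *: t f)) => [|j jm].
  by rewrite /mfps_peval mmapZ -scalerAl mul1r.
by rewrite mcoeffZ mfps_truncE.
Qed.

Lemma mfps_subst_var i : mfps_subst (mfps_var R i) = u i.
Proof.
apply/mfpsP => m; rewrite (@mfps_substE _ 'X_i) => [|j jm].
  by rewrite /mfps_peval mmapX mmap1U.
by rewrite mcoeffX /= eq_sym.
Qed.

End Substitution.

Section Automorphism.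
Variables (n : nat) (k : fieldType) (wt : 'I_n -> nat).
Variables (u : 'I_n -> mfps n k) (a : 'I_n -> k).
Local Notation S := (mfps n k).
Hypothesis u_leads : forall i, leads wt (u i) U_(i)%MM (a i).
Hypothesis a_neq0 : forall i, a i != 0.

Let ua (m : 'X_{1..n}) : k := \prod_i a i ^+ m i.

Lemma mmap1_leads m : leads wt (mmap1 u m) m (ua m).
Proof.
rewrite /mmap1 /ua {2}[m]multinomUE_id.
elim/big_rec3: _ => [|i f m' b _ IHf]; first exact: leads1.
apply: leadsM IHf; elim: (m i) => [|r IHr]; first exact: leads1.
by rewrite mulmS !exprS; apply: leadsM.
Qed.

(** If each [u_i] is a nonzero multiple of the [i]-th variable plus heavier
    terms, then substitution of the [u_i] is triangular with respect to the
    weight, with nonzero diagonal entries [ua m]; it is inverted by recursion on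
    the weight. *)
Lemma mfps_autP : exists2 phi : {lrmorphism S -> S},
  bijective phi & forall i, phi (mfps_var k i) = u i.
Proof.
have u0 i : u i (0%MM : 'X_{1..n}) = 0.
  rewrite u_leads ?wdeg0 //; case: eqP => // /mnmP/(_ i).
  by rewrite mnm1E mnm0E eqxx.
have ua_neq0 m : ua m != 0 by apply/prodf_neq0 => i _; rewrite expf_neq0.
pose phiZ := GRing.isZmodMorphism.Build _ _ _ (mfps_subst_zmod u0).
pose phiM := GRing.isMonoidMorphism.Build _ _ _ (mfps_subst_monoid u0).
pose phiS := GRing.isScalable.Build _ _ _ _ _ (mfps_subst_scalable u0).
pose phi : {lrmorphism S -> S} := HB.pack (mfps_subst u) phiZ phiM phiS.
have phi_low (f : S) m :
    (forall j, (wdeg wt j < wdeg wt m)%N -> f j = 0) -> phi f m = ua m * f m.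
  move=> f0; rewrite (_ : phi f m = mfps_subst u f m) // /mfps_subst /=.
  rewrite mfps_pevalE; set t := mfps_trunc _ f.
  have tE j : j \in msupp t ->
      t@_j * mmap1 u j m = if j == m then ua m * f m else 0.
    move=> jt; have [jm|mj] := ltnP (wdeg wt j) (wdeg wt m).
      have [jm'|mj] := leqP (mdeg j) (mdeg m); last first.
        rewrite mmap1_low // mulr0; case: eqP => // jm'.
        by rewrite jm' ltnn in jm.
      rewrite mfps_truncE // (f0 j) // mul0r; case: eqP => // jmE.
      by rewrite jmE ltnn in jm.
    rewrite mmap1_leads // eq_sym; case: eqP => [->|_]; last by rewrite mulr0.
    by rewrite mfps_truncE // mulrC.
  rewrite (eq_big_seq _ tE); have [mt|] := boolP (m \in msupp t); last first.
    rewrite -mcoeff_eq0 mfps_truncE // => /eqP->.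
    by rewrite mulr0 big1 // => j _; case: ifP.
  rewrite (bigD1_seq m) ?msupp_uniq //= eqxx big1 ?addr0 //.
  by move=> j /negbTE->.
exists phi; last exact: mfps_subst_var.
have phi_surj g : exists f, phi f = g.
  (* Each step corrects the coefficient at [m] by the error there, divided by
     the diagonal entry. *)
  pose T (f : 'X_{1..n} -> k) m := f m + (ua m)^-1 * (g m - phi (MFps f) m).
  have [f fT] : exists f, forall m, T f m = f m.
    apply: (@measured_fixpoint _ _ (wdeg wt) _ (fun=> 0)) => f f' m ff'.
    have E : phi (MFps f) m - phi (MFps f') m = ua m * (f m - f' m).
      rewrite -[LHS]/((phi (MFps f) - phi (MFps f')) m) -raddfB phi_low // => j.
      by move/ff' => fj; rewrite mfpsDE mfpsNE /= fj subrr.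
    rewrite /T; move: (phi _ m) (phi _ m) E => b b' /(canRL (subrK _)) ->.
    apply/eqP; rewrite -subr_eq0.
    by apply/eqP; field.
  exists (MFps f); apply/mfpsP => m; have := fT m; rewrite /T.
  rewrite -[X in _ = X]addr0 => /addrI/eqP.
  by rewrite mulf_eq0 invr_eq0 (negbTE (ua_neq0 m)) subr_eq0 => /eqP.
have phi_inj : injective phi.
  move=> f f' /eqP; rewrite -subr_eq0 -raddfB => /eqP fE.
  apply/eqP; rewrite -subr_eq0; apply/eqP/mfpsP => m.
  have [d] := ubnP (wdeg wt m); elim: d m => // d IHd m md.
  have := congr1 (fun g : S => g m) fE; rewrite phi_low => [/eqP|j jm].
    by rewrite mulf_eq0 (negbTE (ua_neq0 m)) => /eqP.
  by apply: IHd; apply: leq_trans jm _.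
have [psi psiK] := choice phi_surj.
by exists psi => // f; apply: phi_inj; rewrite psiK.
Qed.

End Automorphism.

(** * Isomorphisms of quotients by principal ideals *)

Lemma lrmorphism_inverse (k : nzRingType) (A B : lalgType k)
    (phi : {lrmorphism A -> B}) : bijective phi ->
  exists2 psi : {lrmorphism B -> A}, cancel phi psi & cancel psi phi.
Proof.
case=> psi phiK psiK.
pose psiZ := GRing.isZmodMorphism.Build _ _ _ (can2_zmod_morphism phiK psiK).
pose psiM := GRing.isMonoidMorphism.Build _ _ _ (can2_monoid_morphism phiK psiK).
pose psiS := GRing.isScalable.Build _ _ _ _ _ (can2_scalable phiK psiK).
pose psi' : {lrmorphism B -> A} := HB.pack psi psiZ psiM psiS.
by exists psi'.
Qed.

(** An isomorphism of algebras that maps [a] to a unit times [b] maps the ideal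
    of [a] onto the ideal of [b]. *)
Lemma quot_alg_isomorphic_of_iso (k : comNzRingType) (A B : comAlgType k)
    (a : A) (b c d : B) (phi : {lrmorphism A -> B}) :
  bijective phi -> phi a = c * b -> d * c = 1 -> quot_alg_isomorphic a b.
Proof.
move=> /lrmorphism_inverse[psi phiK psiK] phia dc1.
pose theta (x : pquot a) : pquot b := pquot_pi b (phi (pquot_repr x)).
have thetaE f : theta (pquot_pi a f) = pquot_pi b (phi f).
  apply/pquot_piP; have /pquot_piP[t tE] := pquot_reprK (pquot_pi a f).
  by exists (phi t * c); rewrite -raddfB tE /= rmorphM /= phia mulrA.
have thetaZ : zmod_morphism theta.
  move=> x y; rewrite -[x]pquot_reprK -[y]pquot_reprK -raddfB /= !thetaE.
  by rewrite !raddfB.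
have thetaM : monoid_morphism theta.
  split=> [|x y]; first by rewrite [LHS](thetaE 1) !rmorph1.
  by rewrite -[x]pquot_reprK -[y]pquot_reprK -rmorphM /= !thetaE !rmorphM.
pose theta' : {rmorphism pquot a -> pquot b} := HB.pack theta
  (GRing.isZmodMorphism.Build _ _ _ thetaZ)
  (GRing.isMonoidMorphism.Build _ _ _ thetaM).
exists theta'; split=> [e x|].
  by rewrite -[x]pquot_reprK -linearZ /= !thetaE !linearZ.
exists (fun y => pquot_pi a (psi (pquot_repr y))).
  move=> x; rewrite -[x in RHS]pquot_reprK; apply/pquot_piP.
  have /pquot_piP[t tE] := pquot_reprK (theta x).
  exists (psi (t * d)); apply: (bij_inj (Bijective phiK psiK)).
  by rewrite raddfB /= psiK tE rmorphM /= psiK phia mulrA -(mulrA t) dc1 mulr1.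
by move=> y; rewrite [LHS]thetaE psiK pquot_reprK.
Qed.

(** * Coordinate changes in three variables *)

Definition wt3 (a b c : nat) (i : 'I_3) : nat := nth 0%N [:: a; b; c] i.

Lemma wdeg3 a b c m :
  wdeg (wt3 a b c) m = (a * m ix + b * m iy + c * m iz)%N.
Proof.
rewrite /wdeg !big_ord_recl big_ord0 /= addn0 addnA !(mulnC _ (m _)).
by congr (m _ * _ + m _ * _ + m _ * _)%N; apply: val_inj.
Qed.

Lemma mnm3_ext (m p : 'X_{1..3}) :
  m ix = p ix -> m iy = p iy -> m iz = p iz -> m = p.
Proof.
move=> ex ey ez; apply/mnmP => -[[|[|[|i]]] // lti].
- by have -> : Ordinal lti = ix by apply: val_inj.
- by have -> : Ordinal lti = iy by apply: val_inj.
- by have -> : Ordinal lti = iz by apply: val_inj.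
Qed.

Lemma mnm3_eqE (m p : 'X_{1..3}) :
  (m == p) = [&& m ix == p ix, m iy == p iy & m iz == p iz].
Proof.
apply/eqP/and3P => [->|[/eqP? /eqP? /eqP?]]; first by rewrite !eqxx.
exact: mnm3_ext.
Qed.

Definition mnm3E := (@mnmDE 3, @mnmBE 3, @mulmnE 3, @mnm1E 3, @mnm0E 3).

Ltac mnm3_lia := rewrite ?mnm3_eqE ?wdeg3 ?mnm3E /=; lia.
Ltac mnm3_eq := apply: mnm3_ext; mnm3_lia.

Section Singularities.
Variable k : fieldType.
Local Notation S := (mfps 3 k).
Local Notation leads := (leads (wt3 3 2 3)).

(** The weights 3, 2, 3 are those for which [splitting] below yields series [X]
    and [Y] of the required shape. *)
Lemma coordinate_change (X Y : S) (a : k) : a != 0 ->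
    leads X U_(ix)%MM a -> leads Y U_(iy)%MM 1 ->
  exists2 phi : {lrmorphism S -> S}, bijective phi &
    [/\ phi X = xv k, phi Y = yv k & phi (zv k) = zv k].
Proof.
move=> a0 leads_X leads_Y.
pose u i := nth 0 [:: X; Y; zv k] (val (i : 'I_3)).
pose b i := nth 0 [:: a; 1; 1] (val (i : 'I_3)).
have lead i : leads (u i) U_(i)%MM (b i).
  by case: i => [[|[|[|i]]] lti].
have b0 i : b i != 0 by case: i => [[|[|[|i]]] lti] //=; rewrite oner_eq0.
have [theta theta_bij thetaE] := mfps_autP lead b0.
have [phi thetaK phiK] := lrmorphism_inverse theta_bij.
exists phi; first by exists theta.
by split; apply: (bij_inj theta_bij); rewrite phiK thetaE.
Qed.

Lemma A_infty_sing_product (X Y : S) :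
  leads X U_(ix)%MM 1 -> leads Y U_(iy)%MM 1 -> A_infty_sing (X * Y).
Proof.
move=> leads_X leads_Y.
have [phi phi_bij [phiX phiY _]] :=
  coordinate_change (oner_neq0 k) leads_X leads_Y.
by exists phi; rewrite rmorphM /= phiX phiY.
Qed.

(** With [t = - v^-1] the given series is [- v (t X Y - z^(n+1))], and [t X],
    [Y], [z] are coordinates. *)
Lemma A_sing_product (X Y v : S) n : v \is a GRing.unit ->
    leads X U_(ix)%MM 1 -> leads Y U_(iy)%MM 1 ->
  A_sing n (X * Y + zv k ^+ n.+1 * v).
Proof.
move=> Uv leads_X leads_Y; set t := - v^-1.
have Ut : t \is a GRing.unit by rewrite unitrN unitrV.
have lead_t : leads t 0%MM (t 0%MM).
  move=> m; rewrite wdeg0 wdeg3 => m0; have -> : m = 0%MM by mnm3_eq.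
  by rewrite eqxx.
have := leadsM lead_t leads_X; rewrite mulr1 add0m => leadtX.
have [phi phi_bij [phiX phiY phiz]] :=
  coordinate_change (mfps_unit_neq0 Ut) leadtX leads_Y.
apply: (@quot_alg_isomorphic_of_iso _ _ _ _ _ (phi (- v)) (phi t) phi) => //;
  last first.
  by rewrite -rmorphM mulrNN mulVr // rmorph1.
have -> : xv k * yv k - zv k ^+ n.+1 = phi (t * X * Y - zv k ^+ n.+1).
  by rewrite rmorphB rmorphM rmorphXn /= phiX phiY phiz.
rewrite -rmorphM; congr (phi _).
have vt : v * t = -1 by rewrite /t mulrN divrr.
have -> : - v * (t * X * Y - zv k ^+ n.+1) = - (v * t) * X * Y + zv k ^+ n.+1 * v.
  by ring.
by rewrite vt opprK mul1r.
Qed.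

End Singularities.

(** * Splitting off a product *)

Section Splitting.
Variable k : fieldType.
Local Notation S := (mfps 3 k).
Local Notation w := (wdeg (wt3 3 2 3)).
Implicit Types (D E : S) (m p q : 'X_{1..3}).

Definition zpart D : S :=
  MFps (fun m => if (m ix == 0%N) && (m iy == 0%N) then D m else 0).
Definition xquo D : S := MFps (fun m => D (m + U_(ix))%MM).
(** The quotient by [y] of the terms that are not divisible by [x]. *)
Definition yquo D : S :=
  MFps (fun m => if m ix == 0%N then D (m + U_(iy))%MM else 0).

Lemma xyz_decomposition D : D = zpart D + xv k * xquo D + yv k * yquo D.
Proof.
apply/mfpsP => m; rewrite !mfpsDE !mfps_varME /=.
have [mx|mx] := posnP (m ix); rewrite /= ?add0r.
  have [my|my] := posnP (m iy); rewrite /= ?addr0 // !add0r.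
  by rewrite ifT; [congr (D _); mnm3_eq | mnm3_lia].
rewrite (_ : (if (0 < m iy)%N then _ else 0) = 0); last first.
  by case: ifP => // _; rewrite ifF //; mnm3_lia.
by rewrite addr0; congr (D _); mnm3_eq.
Qed.

(** The terms of weight at least 6, and those in [z] alone, are allowed.  The
    lightest other monomials, [x], [y], [x y], [y z] and [y^2], are the ones
    that would make [xquo E] start before weight 3 or [yquo E] before 4. *)
Definition quasi_axial E :=
  forall m, (w m < 6)%N -> (0 < m ix + m iy)%N -> E m = 0.

Lemma xquo_low D p : quasi_axial D -> (w p < 3)%N -> xquo D p = 0.
Proof. by move=> D0 wp; apply: D0; move: wp; mnm3_lia. Qed.

Lemma yquo_low D q : quasi_axial D -> (w q < 4)%N -> yquo D q = 0.
Proof.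
by move=> D0 wq /=; case: ifP => // _; apply: D0; move: wq; mnm3_lia.
Qed.

(** The implicit equation that turns [x y + E] into [X Y + c(z)], see
    [split_form]. *)
Lemma splitting E : quasi_axial E ->
  exists2 D, quasi_axial D & D = E - xquo D * yquo D.
Proof.
move=> E0.
(* The quotients are truncated below weights 3 and 4, which makes the equation
   a recursion on the weight from the start; the truncation turns out to have
   no effect on the solution.  In a product of terms of weights [wp >= 3] and
   [wq >= 4], the coefficients of [f] involved have weights [wp + 3] and
   [wq + 2], both smaller than [wp + wq]. *)
pose B (f : 'X_{1..3} -> k) : S :=
  MFps (fun p => if (3 <= w p)%N then xquo (MFps f) p else 0).
pose A (f : 'X_{1..3} -> k) : S :=
  MFps (fun q => if (4 <= w q)%N then yquo (MFps f) q else 0).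
pose T (f : 'X_{1..3} -> k) m := E m - (B f * A f) m.
have [f fT] : exists f, forall m, T f m = f m.
  apply: (@measured_fixpoint _ _ w _ (fun=> 0)) => f f' m ff'.
  congr (_ - _); apply: mfpsM_eq => p q pq /=.
  have [wp|wp] := leqP 3 (w p); last by rewrite !mul0r.
  have [wq|wq] := leqP 4 (w q); last by rewrite !mulr0.
  have [fp fq] : f (p + U_(ix))%MM = f' (p + U_(ix))%MM /\
      f (q + U_(iy))%MM = f' (q + U_(iy))%MM.
    by split; apply: ff'; move: wp wq; rewrite -pq; mnm3_lia.
  by rewrite fp fq.
have f_axial : quasi_axial (MFps f).
  move=> m wm mxy; rewrite /= -fT /T E0 // mfpsM_eq0 ?subrr // => p q pq /=.
  have [wp|wp] := leqP 3 (w p); last by rewrite mul0r.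
  have [wq|wq] := leqP 4 (w q); last by rewrite mulr0.
  by move: wm wp wq; rewrite -pq; mnm3_lia.
exists (MFps f) => //; apply/mfpsP => m.
rewrite mfpsDE mfpsNE -[LHS]/(f m) -fT; congr (_ - _); apply: mfpsM_eq => p q _.
congr (_ * _); rewrite /=.
  by have [//|wp] := leqP 3 (w p); exact/esym/(xquo_low f_axial wp).
by have [//|wq] := leqP 4 (w q); exact/esym/(yquo_low f_axial wq).
Qed.

Lemma leads_X D : quasi_axial D ->
  leads (wt3 3 2 3) (xv k + yquo D) U_(ix)%MM 1.
Proof.
move=> D0 m wm; rewrite mfpsDE (yquo_low D0) ?addr0 //.
by move: wm; mnm3_lia.
Qed.

Lemma leads_Y D : quasi_axial D ->
  leads (wt3 3 2 3) (yv k + xquo D) U_(iy)%MM 1.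
Proof.
move=> D0 m wm; rewrite mfpsDE (xquo_low D0) ?addr0 //.
by move: wm; mnm3_lia.
Qed.

Lemma split_form D E : D = E - xquo D * yquo D ->
  xv k * yv k + E = (xv k + yquo D) * (yv k + xquo D) + zpart D.
Proof.
move=> DE; have := xyz_decomposition D; rewrite {1}DE => /(canRL (subrK _)) ->.
by ring.
Qed.

(** * The coefficients on the z-axis *)

(** For the weights [N - r], [r], [1] the product [x y] has weight [N], and the
    edge of weight [N] of the Newton diagram of [E] is met by [x z^r] and by the
    monomials [y^j z^(N - j r)]. *)

Section QuasiHomogeneous.
Variables (r N : nat).
Hypotheses (r_gt0 : (0 < r)%N) (rN : (2 * r < N)%N).
Local Notation v := (wdeg (wt3 (N - r) r 1)).
Variables D E : S.
Hypotheses (D0 : quasi_axial D) (DE : D = E - xquo D * yquo D).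
Hypothesis E0 :
  forall m, (v m < N)%N -> (0 < m ix + m iy)%N -> E m = 0.

Let DmE m : D m = E m - (xquo D * yquo D) m.
Proof. by rewrite {1}DE. Qed.

(** If [p + q] is lighter than [N], then [p] is lighter than [r] or [q] lighter
    than [N - r], so [x p] or [y q] is lighter than [N] and not a power of [z].
    The induction is on the other weight, in which [x p] and [y q] are lighter
    than [p + q]. *)
Lemma below_weight m : (v m < N)%N -> D m = E m.
Proof.
have [d] := ubnP (w m); elim: d m => // d IHd m wm vm.
rewrite DmE mfpsM_eq0 ?subr0 // => p q pq.
have [wp|wp] := ltnP (w p) 3; first by rewrite (xquo_low D0 wp) mul0r.
have [wq|wq] := ltnP (w q) 4; first by rewrite (yquo_low D0 wq) mulr0.
have [vp|vp] := ltnP (v p) r.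
  rewrite /= IHd ?E0 ?mul0r //; move: wm vm wp wq vp; rewrite -pq; mnm3_lia.
have vq : (v q < N - r)%N by move: vm vp; rewrite -pq wdegD; lia.
rewrite [yquo D q]/=; case: ifP; rewrite ?mulr0 // => _.
rewrite IHd ?E0 ?mulr0 //; move: wm vm wp wq vq; rewrite -pq; mnm3_lia.
Qed.

Lemma xquo_below p : (v p < r)%N -> xquo D p = 0.
Proof.
by move=> vp; rewrite /= below_weight ?E0 //; move: vp; mnm3_lia.
Qed.

Lemma yquo_below q : (v q < N - r)%N -> yquo D q = 0.
Proof.
move=> vq /=; case: ifP => // _.
by rewrite below_weight ?E0 //; move: vq; mnm3_lia.
Qed.

Let yz j : 'X_{1..3} := (U_(iy) *+ j + U_(iz) *+ (N - j * r))%MM.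

(** The only other monomial of weight [r] is [y], as [x] has weight
    [N - r > r]; and [quasi_axial] excludes a term [x y] of [D]. *)
Lemma xquo_edge p : v p = r -> p != (U_(iz) *+ r)%MM -> xquo D p = 0.
Proof.
move=> vp pz; apply: (xquo_low D0); move: vp pz; rewrite !wdeg3.
case px: (p ix) => [|a].
  case py: (p iy) => [|[|b]]; rewrite ?mulnS; try by lia.
  by move=> vp /eqP[]; mnm3_eq.
by rewrite mulnS; move: ((N - r) * a)%N (r * p iy)%N => b c; lia.
Qed.

(** The product [xquo D * yquo D] has no term [x z^r]: the factor [x] must come
    from [xquo D], which leaves for [yquo D] a power of [z] of exponent at most
    [r], and [r < N - r]. *)
Lemma xquo_corner : xquo D (U_(iz) *+ r)%MM = E (U_(ix) + U_(iz) *+ r)%MM.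
Proof.
rewrite /= addmC DmE mfpsM_eq0 ?subr0 // => p q pq.
have [q0|] := eqVneq (q ix) 0%N; last first.
  by move=> q0; rewrite [yquo D q]/= (negbTE q0) mulr0.
rewrite yquo_below ?mulr0 //.
have := congr1 (fun m : 'X_{1..3} => m ix) pq.
have := congr1 (fun m : 'X_{1..3} => m iy) pq.
have := congr1 (fun m : 'X_{1..3} => m iz) pq.
rewrite wdeg3 !mnm3E /= => ez ey ex.
have qy : q iy = 0%N by lia.
by rewrite q0 qy; lia.
Qed.

(** On the edge the two weights [v p >= r] and [v q >= N - r] must be equalities,
    which forces [p = z^r]. *)
Lemma edge_recursion j : (j.+1 * r <= N)%N ->
  D (yz j) = E (yz j) - E (U_(ix) + U_(iz) *+ r)%MM * D (yz j.+1).
Proof.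
move=> jr; rewrite DmE; congr (_ - _).
have yzE : yz j = (U_(iz) *+ r + (U_(iy) *+ j + U_(iz) *+ (N - j.+1 * r)))%MM.
  by rewrite /yz; mnm3_eq.
rewrite yzE mfpsM_single ?xquo_corner.
  congr (_ * _); rewrite /= ifT; last by mnm3_lia.
  by congr (D _); rewrite /yz; mnm3_eq.
move=> p q pq pz.
have vpq : (v p + v q = N)%N.
  by rewrite -wdegD pq; mnm3_lia.
have [vp|vp|vp] := ltngtP (v p) r; first by rewrite xquo_below // mul0r.
  by rewrite yquo_below ?mulr0 //; lia.
by rewrite xquo_edge // mul0r.
Qed.

(** For the last [j] with [j r <= N] the exponent of [z] is smaller than [r], and
    the recursion stops. *)
Lemma edge_end j : (N < j.+1 * r)%N -> (j * r <= N)%N -> D (yz j) = E (yz j).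
Proof.
move=> Nj jN; rewrite DmE mfpsM_eq0 ?subr0 // => p q pq.
have vpq : (v p + v q = N)%N.
  by rewrite -wdegD pq /yz; mnm3_lia.
have [vp|vp|vp] := ltngtP (v p) r; first by rewrite xquo_below // mul0r.
  by rewrite yquo_below ?mulr0 //; lia.
have [pz|pz] := eqVneq p (U_(iz) *+ r)%MM; last by rewrite xquo_edge // mul0r.
have := congr1 (fun m : 'X_{1..3} => m iz) pq.
by rewrite pz /yz !mnm3E /=; lia.
Qed.

Lemma zcoef_formula : D (U_(iz) *+ N)%MM =
  \sum_(0 <= j < (N %/ r).+1) (- E (U_(ix) + U_(iz) *+ r)%MM) ^+ j * E (yz j).
Proof.
set a := E (U_(ix) + U_(iz) *+ r)%MM.
have partial J : (J * r <= N)%N -> D (U_(iz) *+ N)%MM =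
    \sum_(0 <= j < J) (- a) ^+ j * E (yz j) + (- a) ^+ J * D (yz J).
  elim: J => [_|J IHJ Jr].
    rewrite big_nil add0r mul1r; congr (D _).
    by rewrite /yz; mnm3_eq.
  rewrite IHJ; last by lia.
  by rewrite big_nat_recr //= edge_recursion // exprS /a; ring.
rewrite (partial _ (leq_trunc_div N r)) big_nat_recr //=.
rewrite edge_end ?leq_trunc_div //.
by rewrite -ltn_divLR.
Qed.

End QuasiHomogeneous.

End Splitting.

(** * The type of the singularity from the z-axis coefficients *)

Section AxisOrder.
Variable k : fieldType.
Local Notation S := (mfps 3 k).
Variables D E : S.
Hypotheses (D0 : quasi_axial D) (DE : D = E - xquo D * yquo D).

Lemma zpart_neq m : zpart D m != 0 -> m = (U_(iz) *+ m iz)%MM /\ D m != 0.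
Proof.
rewrite /=; case: ifP => [/andP[/eqP mx /eqP my] Dm|]; last by rewrite eqxx.
by split=> //; mnm3_eq.
Qed.

Lemma A_infty_of_axis : (forall i, D (U_(iz) *+ i)%MM = 0) ->
  A_infty_sing (xv k * yv k + E).
Proof.
move=> Dz; have zD : zpart D = 0.
  apply/mfpsP => m; apply/eqP/negPn/negP => /zpart_neq[-> ].
  by rewrite Dz eqxx.
rewrite (split_form DE) zD addr0.
by apply: A_infty_sing_product; [exact: leads_X|exact: leads_Y].
Qed.

Lemma A_sing_of_axis n : (forall i, (i <= n)%N -> D (U_(iz) *+ i)%MM = 0) ->
  D (U_(iz) *+ n.+1)%MM != 0 -> A_sing n (xv k * yv k + E).
Proof.
move=> Dlow Dn; pose v : S := MFps (fun m => zpart D (m + U_(iz) *+ n.+1)%MM).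
have zD : zpart D = zv k ^+ n.+1 * v.
  apply/mfpsP => m; rewrite mfps_var_expM.
  have [nm|mn] := ltnP n (m iz); first by congr (zpart D _); mnm3_eq.
  apply/eqP/negPn/negP => /zpart_neq[->].
  by rewrite Dlow ?eqxx.
rewrite (split_form DE) zD; apply: A_sing_product; [|exact: leads_X|exact: leads_Y].
by apply: mfps_unitP; rewrite /= !add0m ifT //; mnm3_lia.
Qed.

End AxisOrder.

(** * The coefficients of F and of H *)

Section CoefficientsOfF.
Variable k : fieldType.
Local Notation S := (mfps 3 k).
Variables (h : S) (f g : nat -> S) (r : nat).
Implicit Types (D : S) (m p q : 'X_{1..3}).
Local Notation P := (\msum_(i in [set i | (1 <= i)%N]) (xv k ^+ i * f i)).
Local Notation Q := (\msum_(j in [set j | (2 <= j)%N]) (yv k ^+ j * g j)).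
Local Notation E := (h + P + Q).
Local Notation H := (h
    + \msum_(j in [set j | (2 <= j)%N]) ((-1) ^+ j * f 1%N ^+ j * g j)).

Lemma mem_geq a i : (i \in [set i | (a <= i)%N]) = (a <= i)%N.
Proof. by apply/idP/idP => [/set_mem|/mem_set]. Qed.

Lemma coef_xsum0 m : m ix = 0%N -> P m = 0.
Proof.
move=> mx; apply: mfps_sum_eq0 => i; rewrite mem_geq => i1.
by rewrite mfps_var_expM mx leqNgt i1.
Qed.

Lemma coef_xsum1 m : m ix = 1%N -> P m = f 1%N (m - U_(ix))%MM.
Proof.
move=> mx; rewrite (@mfps_sumE _ _ _ _ 2) => [|i i2]; last first.
  by rewrite mfps_var_expM mx leqNgt i2.
rewrite big_mkcond big_ltn // big_ltn // big_geq // !mem_geq.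
rewrite [LHS]add0r [LHS]addr0.
by rewrite mfps_var_expM mx.
Qed.

Lemma coef_ysum m :
  Q m = \sum_(0 <= j < (m iy).+1 | (2 <= j)%N) g j (m - U_(iy) *+ j)%MM.
Proof.
rewrite (@mfps_sumE _ _ _ _ (m iy).+1) => [|j jm]; last first.
  by rewrite mfps_var_expM leqNgt jm.
rewrite [LHS]big_nat_cond [RHS]big_nat_cond; apply: eq_big => [j|j].
  by rewrite mem_geq.
by case/andP => /andP[_ jm] _; rewrite mfps_var_expM -ltnS jm.
Qed.

Hypothesis hz : in_kz h.
Hypothesis f1_low : forall m : 'X_{1..3}, (m iz < r)%N -> f 1%N m = 0.
Hypothesis r_gt0 : (0 < r)%N.

Lemma h_off m : (0 < m ix + m iy)%N -> h m = 0.
Proof. by move=> mxy; apply/eqP/negPn/negP => /hz[mx my]; lia. Qed.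

(** Below weight 6 the candidates are [x], [x y], [y^2] and [y z]: the first two
    need a term of [f_1] without [z], the third one a term of [g_2] without
    [z], and a single [y] does not occur. *)
Lemma rest_quasi_axial :
  (forall m : 'X_{1..3}, m iz = 0%N -> g 2%N m = 0) -> quasi_axial E.
Proof.
move=> g2 m; rewrite wdeg3 => wm mxy; rewrite !mfpsDE h_off // add0r.
have -> : P m = 0.
  have [mx|mx] := leqP (m ix) 0; first by apply: coef_xsum0; lia.
  by rewrite coef_xsum1 ?f1_low //; mnm3_lia.
rewrite add0r coef_ysum big_nat_cond big1 // => j /andP[/andP[_ jm] j2].
by have -> : j = 2%N; [lia|rewrite g2 //; mnm3_lia].
Qed.

Variable N : nat.
Hypothesis rN : (2 * r < N)%N.
Hypothesis g_low : forall j (m : 'X_{1..3}),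
  (2 <= j)%N -> (j * r + m iz < N)%N -> g j m = 0.
Local Notation v := (wdeg (wt3 (N - r) r 1)).

(** Terms divisible by [x^2] have weight at least [2 (N - r) > N], and the
    remaining ones are bounded below by [x z^r] and the [y^j z^(ord g_j)]. *)
Lemma rest_below m : (v m < N)%N -> (0 < m ix + m iy)%N -> E m = 0.
Proof.
rewrite wdeg3 => vm mxy; rewrite !mfpsDE h_off // add0r.
have -> : P m = 0.
  case mx: (m ix) vm => [|[|a]] vm; first exact: coef_xsum0.
    by rewrite coef_xsum1 ?f1_low //; mnm3_lia.
  by exfalso; nia.
rewrite add0r coef_ysum big_nat_cond big1 // => j /andP[/andP[_ jm] j2].
rewrite g_low // !mnm3E /=.
have : (j * r <= m iy * r)%N by rewrite leq_mul2r -ltnS jm orbT.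
by lia.
Qed.

Lemma rest_axis i : E (U_(iz) *+ i)%MM = h (U_(iz) *+ i)%MM.
Proof.
rewrite !mfpsDE coef_xsum0; last by mnm3_lia.
rewrite coef_ysum addr0 big_nat_cond big1 ?addr0 // => j.
by rewrite !mnm3E /=; lia.
Qed.

Lemma rest_corner :
  E (U_(ix) + U_(iz) *+ r)%MM = f 1%N (U_(iz) *+ r)%MM.
Proof.
rewrite !mfpsDE h_off ?add0r; last by mnm3_lia.
rewrite coef_xsum1; last by mnm3_lia.
rewrite coef_ysum big_nat_cond big1 => [|j]; last by rewrite !mnm3E /=; lia.
by rewrite addr0; congr (f 1%N _); mnm3_eq.
Qed.

(** For [i < j] the term [y^i g_i] does not meet [y^j z^(N - j r)]: its power of
    [z] is at least [N - i r > N - j r]. *)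
Lemma rest_edge j : (j * r <= N)%N ->
  E (U_(iy) *+ j + U_(iz) *+ (N - j * r))%MM =
    (if j == 0%N then h (U_(iz) *+ N)%MM else 0)
    + (if (2 <= j)%N then g j (U_(iz) *+ (N - j * r))%MM else 0).
Proof.
move=> jN; rewrite !mfpsDE coef_xsum0 ?addr0; last by mnm3_lia.
congr (_ + _).
  case: eqP => [->|/eqP j0]; last by rewrite h_off //; mnm3_lia.
  by congr (h _); mnm3_eq.
rewrite coef_ysum (_ : _ iy = j); last by mnm3_lia.
rewrite big_mkcond big_nat_recr //= big_nat_cond big1 ?add0r.
  by case: ifP => // _; congr (g j _); mnm3_eq.
move=> i /andP[/andP[_ ij] _]; case: ifP => // i2; apply: g_low => //.
have : (i * r < j * r)%N by rewrite ltn_mul2r ij r_gt0.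
by rewrite !mnm3E /=; lia.
Qed.

(** [f_1 = z^r u]; the term of index [j] of [H] is then [z^(j r)] times
    [(- u)^j g_j]. *)
Let u : S := MFps (fun m => f 1%N (m + U_(iz) *+ r)%MM).

Lemma f1_factor : f 1%N = zv k ^+ r * u.
Proof.
apply/mfpsP => m; rewrite mfps_var_expM; case: leqP => [rm|mr].
  by rewrite /u /=; congr (f 1%N _); mnm3_eq.
exact: f1_low.
Qed.

Lemma H_termE j :
  (-1) ^+ j * f 1%N ^+ j * g j = zv k ^+ (j * r) * ((- u) ^+ j * g j).
Proof.
by rewrite f1_factor exprMn -exprM (mulnC r) [in RHS]exprNn; ring.
Qed.

(** Since [g_j] is divisible by [z^(N - j r)], only the constant term of [u]
    contributes. *)
Lemma H_edge j : (2 <= j)%N -> (j * r <= N)%N ->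
  ((-1) ^+ j * f 1%N ^+ j * g j) (U_(iz) *+ N)%MM =
    (- f 1%N (U_(iz) *+ r)%MM) ^+ j * g j (U_(iz) *+ (N - j * r))%MM.
Proof.
move=> j2 jN; rewrite H_termE mfps_var_expM ifT; last by mnm3_lia.
have -> : (U_(iz) *+ N - U_(iz) *+ (j * r))%MM
    = (0 + U_(iz) *+ (N - j * r))%MM :> 'X_{1..3} by mnm3_eq.
rewrite mfpsM_single => [|p q pq p0].
  congr (_ * _).
  have u0 (i : nat) : ((- u) ^+ i) (0%MM : 'X_{1..3}) =
      (- f 1%N (U_(iz) *+ r)%MM) ^+ i.
    elim: i => [|i IHi]; first by rewrite !expr0 mfps1E eqxx.
    rewrite !exprS mfpsM0 IHi.
    by congr (- f 1%N _ * _); rewrite add0m.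
  exact: u0.
rewrite [g j q]g_low ?mulr0 //.
have := congr1 (fun m : 'X_{1..3} => m ix) pq.
have := congr1 (fun m : 'X_{1..3} => m iy) pq.
have := congr1 (fun m : 'X_{1..3} => m iz) pq.
by move: p0; rewrite mnm3_eqE !mnm3E /=; lia.
Qed.

Lemma H_axis : H (U_(iz) *+ N)%MM = h (U_(iz) *+ N)%MM +
  \sum_(0 <= j < (N %/ r).+1 | (2 <= j)%N)
    (- f 1%N (U_(iz) *+ r)%MM) ^+ j * g j (U_(iz) *+ (N - j * r))%MM.
Proof.
rewrite mfpsDE; congr (_ + _).
rewrite (@mfps_sumE _ _ _ _ (N %/ r).+1) => [|j].
  rewrite [LHS]big_nat_cond [RHS]big_nat_cond; apply: eq_big => [j|j].
    by rewrite mem_geq.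
  rewrite mem_geq ltnS => /andP[/andP[_ jN] j2]; apply: H_edge => //.
  by rewrite -leq_divRL.
rewrite ltn_divLR // => jN; rewrite H_termE mfps_var_expM ifF //.
by mnm3_lia.
Qed.

Lemma zcoef_edge D : quasi_axial D -> D = E - xquo D * yquo D ->
  D (U_(iz) *+ N)%MM = H (U_(iz) *+ N)%MM.
Proof.
move=> D0 DE; rewrite (zcoef_formula r_gt0 rN D0 DE rest_below).
rewrite rest_corner H_axis.
rewrite (eq_big_nat _ _ (F2 := fun j =>
  (if j == 0%N then h (U_(iz) *+ N)%MM else 0) +
  (if (2 <= j)%N then
     (- f 1%N (U_(iz) *+ r)%MM) ^+ j * g j (U_(iz) *+ (N - j * r))%MM
   else 0))); last first.
  move=> j /andP[_ jN]; rewrite rest_edge; last by rewrite -leq_divRL.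
  rewrite mulrDr; congr (_ + _); last by case: ifP; rewrite ?mulr0.
  by case: eqP => [->|_]; rewrite ?mul1r ?mulr0.
rewrite big_split /= [in RHS]big_mkcond; congr (_ + _).
by rewrite big_nat_recl //= big1 ?addr0.
Qed.

Lemma H_below i : (i < N)%N -> H (U_(iz) *+ i)%MM = h (U_(iz) *+ i)%MM.
Proof.
move=> iN; rewrite mfpsDE mfps_sum_eq0 ?addr0 // => j; rewrite mem_geq => j2.
rewrite H_termE mfps_var_expM; case: ifP => // ji.
apply: mfpsM_eq0 => p q pq; rewrite [g j q]g_low ?mulr0 //.
have := congr1 (fun m : 'X_{1..3} => m iz) pq.
by move: ji; rewrite !mnm3E /=; lia.
Qed.

Lemma zcoef_h D i : quasi_axial D -> D = E - xquo D * yquo D ->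
  (i < N)%N -> D (U_(iz) *+ i)%MM = h (U_(iz) *+ i)%MM.
Proof.
move=> D0 DE iN; rewrite -rest_axis.
by apply: (below_weight r_gt0 rN D0 DE rest_below); mnm3_lia.
Qed.

Lemma zcoef_H D i : quasi_axial D -> D = E - xquo D * yquo D ->
  (i <= N)%N -> D (U_(iz) *+ i)%MM = H (U_(iz) *+ i)%MM.
Proof.
move=> D0 DE; rewrite leq_eqVlt => /predU1P[->|iN]; first exact: zcoef_edge.
by rewrite zcoef_h // H_below.
Qed.

End CoefficientsOfF.

(** * The theorem *)

Lemma in_ideal_mul_const (k : fieldType) (F : mfps 3 k) :
  ideal_mul (@maxideal k) (@maxideal k) F -> F 0%MM = 0.
Proof.
case=> n [a [b [ab ->]]]; rewrite mfps_bigE big1 // => i _.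
have [_ [c ->]] := ab i; rewrite mfpsM0 mfps_bigE big1 ?mulr0 // => j _.
rewrite mfpsM0 [X in _ * X](_ : _ = 0) ?mulr0 //.
by case: j => [[|[|[|j]]] lj] //; exact: mfps_var0.
Qed.

Lemma zord_low (k : fieldType) (f : mfps 3 k) (n : nat) (m : 'X_{1..3}) :
  elen (Fin n) (zord f) -> (m iz < n)%N -> f m = 0.
Proof.
move=> nf mn; apply/eqP/negPn/negP => fm.
have : elen (zord f) (Fin (m iz)) by apply: emin_le; exists m.
by move: nf; case: (zord f) => //= a; lia.
Qed.

Lemma elen_trans b a c : elen a b -> elen b c -> elen a c.
Proof. by case: a b c => [a|] [b|] [c|] //=; apply: leq_trans. Qed.

Theorem theorem2p6 (k : fieldType) (h : mfps 3 k) (f g : nat -> mfps 3 k)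
    (r1 : nat) :
  let x := xv k in
  let y := yv k in
  let F := x * y + h
    + \msum_(i in [set i | (1 <= i)%N]) (x ^+ i * f i)
    + \msum_(j in [set j | (2 <= j)%N]) (y ^+ j * g j) in
  let m := emin [set eaddn (Fin (j * r1)) (zord (g j))
                | j in [set j | (2 <= j)%N]] in
  let mu := emin [set zord h; m] in
  let H := h
    + \msum_(j in [set j | (2 <= j)%N]) ((-1) ^+ j * f 1%N ^+ j * g j) in
  let delta (d : nat) : k := H (U_(iz) *+ d)%MM in
  in_kz h ->
  (forall i, (1 <= i)%N -> f i = 0 \/ zpow_unit (f i)) ->
  (forall j, (2 <= j)%N -> g j = 0 \/ zpow_unit (g j)) ->
  ideal_mul (@maxideal k) (@maxideal k) F ->
  zord (f 1%N) = Fin r1 ->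
  (0 < r1)%N ->
  zord (g 2%N) <> Fin 0 ->
  (exists2 n : enat, elen (epred mu) n & A_sing_ext n F)
  /\ (forall d : nat, mu = Fin d -> delta d != 0 -> A_sing d.-1 F).
Proof.
move=> x y F m mu H delta hz _ _ F_m2 f1_ord r_gt0 g2_ord.
set E := h + \msum_(i in [set i | (1 <= i)%N]) (x ^+ i * f i)
           + \msum_(j in [set j | (2 <= j)%N]) (y ^+ j * g j).
have FE : F = x * y + E by rewrite /F /E !addrA.
have f1_low (p : 'X_{1..3}) : (p iz < r1)%N -> f 1%N p = 0.
  by apply: zord_low; rewrite f1_ord /=.
have g2_pos : elen (Fin 1) (zord (g 2%N)) by case: (zord _) g2_ord => [[]|].
have m_le j : (2 <= j)%N -> elen m (eaddn (Fin (j * r1)) (zord (g j))).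
  by move=> j2; apply: emin_le; exists j.
have m_gt n : m = Fin n -> (2 * r1 < n)%N.
  move=> mn; have : [set eaddn (Fin (j * r1)) (zord (g j))
      | j in [set j | (2 <= j)%N]] m.
    by apply: emin_mem; exists (eaddn (Fin (2 * r1)) (zord (g 2%N))); exists 2%N.
  rewrite mn; case=> j /= j2; case gj: (zord (g j)) => [e|] //= [<-].
  have [j_eq|j_gt2] : j = 2%N \/ (2 < j)%N by lia.
    by move: g2_pos; rewrite -j_eq gj /=; lia.
  have : (3 * r1 <= j * r1)%N by rewrite leq_mul2r j_gt2 orbT.
  by lia.
have g_low N j (p : 'X_{1..3}) : elen (Fin N) m -> (2 <= j)%N ->
    (j * r1 + p iz < N)%N -> g j p = 0.
  move=> Nm j2 pN; apply: (@zord_low _ _ (N - j * r1)%N); last by lia.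
  have := elen_trans Nm (m_le _ j2); case: (zord (g j)) => //= e; lia.
(* A finite bound that reaches [i]: [m] itself, or any large number if [m] is
   infinite. *)
have m_fin i : elen (Fin i) m ->
    exists N, [/\ (2 * r1 < N)%N, elen (Fin N) m & (i <= N)%N].
  case mE: m => [N|] im; first by exists N; split=> //=; apply: m_gt.
  by exists (2 * r1 + i).+1; split=> //; lia.
have [D D0 DE] : exists2 D, quasi_axial D & D = E - xquo D * yquo D.
  apply: splitting; apply: (rest_quasi_axial hz f1_low r_gt0) => p pz.
  by apply: (zord_low g2_pos); rewrite pz.
have D_H i : elen (Fin i) m -> D (U_(iz) *+ i)%MM = H (U_(iz) *+ i)%MM.
  move=> im; have [N [rN Nm iN]] := m_fin _ im.
  exact: (zcoef_H hz f1_low r_gt0 rN (fun j p => @g_low N j p Nm) D0 DE iN).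
have D_low i : elen (Fin i.+1) mu -> D (U_(iz) *+ i)%MM = 0.
  move=> imu; have im : elen (Fin i.+1) m.
    by apply: elen_trans imu _; apply: emin_le; right.
  have [N [rN Nm iN]] := m_fin _ im.
  rewrite (zcoef_h hz f1_low r_gt0 rN (fun j p => @g_low N j p Nm) D0 DE iN).
  apply: (@zord_low _ _ i.+1); last by mnm3_lia.
  by apply: elen_trans imu _; apply: emin_le; left.
(* As [F] has no constant term and [X], [Y] vanish at the origin, [c(0) = 0]. *)
have D_0 : D (U_(iz) *+ 0)%MM = 0.
  have := in_ideal_mul_const F_m2; rewrite FE (split_form DE) mfpsDE mfpsM0.
  rewrite !mfpsDE (xquo_low D0) ?(yquo_low D0) ?wdeg0 // /x /y.
  rewrite /xv mfps_var0 addr0 mul0r add0r /= ifT; last by mnm3_lia.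
  by move <-; congr (D _); mnm3_eq.
split=> [|d mu_d delta_d].
  have [Dz|] := pselect (forall i, D (U_(iz) *+ i)%MM = 0).
    exists Infty; first by case: (epred mu).
    by rewrite FE; apply: A_infty_of_axis D0 DE Dz.
  move/existsNP => ex; have {}ex : exists i, D (U_(iz) *+ i)%MM != 0.
    by case: ex => i /eqP; exists i.
  case: (ex_minnP ex) => -[|n] Dn n_min; first by rewrite D_0 eqxx in Dn.
  exists (Fin n).
    case mu_e: mu => [e|] /=; last first.
      by move: Dn; rewrite D_low ?mu_e ?eqxx.
    rewrite leqNgt; apply/negP => ne.
    by move: Dn; rewrite D_low ?mu_e /= ?eqxx //; lia.
  have Dlow i : (i <= n)%N -> D (U_(iz) *+ i)%MM = 0.
    by move=> le_in; apply/eqP/negPn/negP => /n_min; rewrite ltnNge le_in.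
  by rewrite FE; exact (A_sing_of_axis D0 DE Dlow Dn).
have Dd : D (U_(iz) *+ d)%MM != 0.
  rewrite D_H //; apply: elen_trans (_ : elen mu m); first by rewrite mu_d /=.
  by apply: emin_le; right.
case: d mu_d delta_d Dd => [|d] mu_d _ Dd; first by rewrite D_0 eqxx in Dd.
have Dlow i : (i <= d)%N -> D (U_(iz) *+ i)%MM = 0.
  by move=> le_id; apply: D_low; rewrite mu_d.
by rewrite FE; exact (A_sing_of_axis D0 DE Dlow Dd).
Qed.
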